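(* Let $b:\mathbb R^d\to\mathbb R^d$, $\sigma:\mathbb R^d\to\mathbb R^{d\times D}$ satisfy: (A1) there are $L_1,L_2>0$ with $\|\sigma(u_1)-\sigma(u_2)\|_{HS}\le L_1|u_1-u_2|$ and $\|\sigma(u)\|_{HS}\le L_2$ for all $u,u_1,u_2\in\mathbb R^d$; (A2) there are $c_1>\frac{15}{2}L_1^2$, $L_3>0$, $q\ge1$ with $\langle u_1-u_2,b(u_1)-b(u_2)\rangle\le -c_1|u_1-u_2|^2$ and $|b(u_1)-b(u_2)|\le L_3(1+|u_1|^{q-1}+|u_2|^{q-1})|u_1-u_2|$ for all $u_1,u_2$. Let $W$ be a $D$-dimensional standard Brownian motion, $\tau>0$, and $\bar X^x_n$ the backward Euler--Maruyama approximation $\bar X_{n+1}=\bar X_n+b(\bar X_{n+1})\tau+\sigma(\bar X_n)\Delta W_n$, $\Delta W_n=W((n+1)\tau)-W(n\tau)$, $\bar X_0=x\in\mathbb R^d$. Then for any $r\ge1$ there is $K(r)>0$ independent of $\tau$ and $x$ such that for all $\tau\le1$ and $x\in\mathbb R^d$, $$\sup_{n\ge0}\mathbf E|\bar X^x_n|^r\le K(r)(1+|x|^r).$$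
   Context: $|\cdot|$ is the Euclidean norm and $\|\cdot\|_{HS}$ the Hilbert--Schmidt norm. *)

(* Defs.v *)
From HB Require Import structures.
From mathcomp Require Import all_boot all_order all_algebra.
From mathcomp Require Import all_classical all_reals all_analysis.
Set Implicit Arguments. Unset Strict Implicit. Unset Printing Implicit Defensive.
Import Order.TTheory GRing.Theory Num.Theory numFieldTopology.Exports.
Local Open Scope classical_set_scope.
Local Open Scope ring_scope.

Definition vnorm {R : realType} {d : nat} (v : 'cV[R]_d) : R :=
  Num.sqrt (\sum_(i < d) v i 0 ^+ 2).

Definition vdot {R : realType} {d : nat} (u v : 'cV[R]_d) : R :=
  \sum_(i < d) u i 0 * v i 0.

Definition hsnorm {R : realType} {d D : nat} (A : 'M[R]_(d, D)) : R :=
  Num.sqrt (\sum_(i < d) \sum_(j < D) A i j ^+ 2).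

(* Mutual independence of a finite family of real random variables:
   product rule for all families of Borel sets (taking B i = setT
   gives the product rule for every subfamily). *)
Definition mutually_independent {dT : measure_display} {T : measurableType dT}
  {R : realType} (P : probability T R) {I : finType} (X : I -> T -> R) : Prop :=
  forall B : I -> set R, (forall i, measurable (B i)) ->
    P (\bigcap_(i in [set: I]) (X i @^-1` B i)) =
    (\prod_(i : I) P (X i @^-1` B i))%E.

Definition is_std_BM {dT : measure_display} {T : measurableType dT}
  {R : realType} (P : probability T R) (D : nat) (W : R -> T -> 'cV[R]_D) : Prop :=
  [/\ forall w, W 0 w = 0,
      forall w (i : 'I_D), {within [set t : R | 0 <= t], continuous ((fun t : R => W t w i 0) : R -> R)},
      forall t (i : 'I_D), 0 <= t -> measurable_fun [set: T] (fun w => W t w i 0),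
      forall (k : nat) (t : nat -> R), 0 <= t 0%N -> (forall j, t j < t j.+1) ->
        mutually_independent P
          (fun p : 'I_k * 'I_D => fun w => W (t p.1.+1) w p.2 0 - W (t (nat_of_ord p.1)) w p.2 0)
    & forall s t (i : 'I_D) (B : set R), 0 <= s -> s < t -> measurable B ->
        P ((fun w => W t w i 0 - W s w i 0) @^-1` B) = normal_prob 0 (Num.sqrt (t - s)) B].

(* Main.v *)
(* Testing the implicit equation against X_{n+1} and using dissipativity gives
   (1 + c tau) |X_{n+1}|^2 <= |Y_n|^2 + O(tau) with Y_n = X_n + sigma(X_n) dW_n.
   The increment dW_n is symmetric and independent of X_n, so E|Y_n|^{2p} is the
   expectation of half of |X_n + sigma dW_n|^{2p} + |X_n - sigma dW_n|^{2p}.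
   In this sum the term linear in dW_n cancels; as sigma is bounded and
   E|dW_n|^{2p} = O(tau^p), the rest is (1 + c tau / 2) E|X_n|^{2p} + O(tau).
   Hence E|X_n|^{2p} <= |x|^{2p} + K by induction on n, and a general exponent r
   follows from t^r <= s^r (t / s)^{2p} + s^r with s = 1 + |x| and r <= 2p.

   X_{n+1} is only known to solve an implicit equation, so its measurability has
   to be proved: u |-> u - tau b(u) is expanding and continuous, and
   the coordinates of its inverse are countable infima. *)
Require Import Defs.
From HB Require Import structures.
From mathcomp Require Import all_boot all_order all_algebra.
From mathcomp Require Import all_classical all_reals all_analysis.
From mathcomp Require Import measurable_realfun ring lra.
Import Order.TTheory GRing.Theory Num.Theory.
Local Open Scope classical_set_scope.
Local Open Scope ring_scope.

(** * Real inequalities *)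

(** Induction on the exponent: multiply the bound by [x], write [x = y + (x - y)], and bound the
    spare factors [x] and [y] by [M]. The quadratic constant then grows by [K], which [(K + 1) ^+ 2]
    absorbs. *)
Lemma taylor_power_le (R : realDomainType) (k : nat) (M x y : R) :
  0 <= x <= M -> 0 <= y <= M ->
  x ^+ k.+2 <= y ^+ k.+2 + k.+2%:R * y ^+ k.+1 * (x - y)
               + k.+2%:R ^+ 2 * M ^+ k * (x - y) ^+ 2.
Proof.
move=> /andP[x0 xM] /andP[y0 yM]; have M0 := le_trans x0 xM.
elim: k => [|k IHk]; first by rewrite expr0 expr1; have := sqr_ge0 (x - y); nra.
set K : R := k.+2%:R in IHk *.
have KE : k.+3%:R = K + 1 :> R by rewrite /K -[in LHS]natr1.
have K0 : 0 <= K by rewrite ler0n.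
have yk0 : 0 <= y ^+ k.+1 by rewrite exprn_ge0.
have ykM : y ^+ k.+1 <= M ^+ k.+1 by rewrite lerXn2r// nnegrE.
have Mk0 : 0 <= M ^+ k by rewrite exprn_ge0.
have s0 : 0 <= (x - y) ^+ 2 by rewrite sqr_ge0.
have xMk : x * M ^+ k <= M ^+ k.+1 by rewrite exprS ler_wpM2r.
rewrite KE [x ^+ k.+3]exprS; apply: le_trans (ler_wpM2l x0 IHk) _.
have ySE : y ^+ k.+2 = y * y ^+ k.+1 by rewrite exprS.
have ySSE : y ^+ k.+3 = y * (y * y ^+ k.+1) by rewrite !exprS.
rewrite ySSE ySE.
have h1 : K * (y ^+ k.+1 * (x - y) ^+ 2) <= K * (M ^+ k.+1 * (x - y) ^+ 2).
  by rewrite ler_wpM2l// ler_wpM2r.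
have h2 : K ^+ 2 * (x * M ^+ k * (x - y) ^+ 2) <= K ^+ 2 * (M ^+ k.+1 * (x - y) ^+ 2).
  by rewrite ler_wpM2l ?sqr_ge0// ler_wpM2r.
have h3 : 0 <= (K + 1) * (M ^+ k.+1 * (x - y) ^+ 2).
  apply: mulr_ge0; first by rewrite addr_ge0.
  by apply: mulr_ge0 => //; exact: exprn_ge0.
have e1 : x * (y * y ^+ k.+1 + K * y ^+ k.+1 * (x - y) + K ^+ 2 * M ^+ k * (x - y) ^+ 2)
  = y * (y * y ^+ k.+1) + (K + 1) * (y * y ^+ k.+1) * (x - y)
    + K * (y ^+ k.+1 * (x - y) ^+ 2) + K ^+ 2 * (x * M ^+ k * (x - y) ^+ 2) by ring.
have e2 : (K + 1) ^+ 2 * M ^+ k.+1 * (x - y) ^+ 2 = K ^+ 2 * (M ^+ k.+1 * (x - y) ^+ 2)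
  + K * (M ^+ k.+1 * (x - y) ^+ 2) + (K + 1) * (M ^+ k.+1 * (x - y) ^+ 2) by ring.
rewrite e1 e2; lra.
Qed.

(** Jensen's inequality with weights [1] and [t]; the induction step rests on
    [0 <= (u - v) * (u ^+ n - v ^+ n)]. It raises a one-step bound to a power while keeping the
    factor [1 + t]. *)
Lemma power_weighted_mean_le (R : realFieldType) (n : nat) (t w u v : R) :
  0 <= t -> 0 <= w -> 0 <= u -> 0 <= v ->
  (1 + t) * w <= u + t * v -> (1 + t) * w ^+ n <= u ^+ n + t * v ^+ n.
Proof.
move=> t0 w0 u0 v0 wuv; have t1 : 0 < 1 + t by rewrite ltr_wpDr.
elim: n => [|n IHn]; first by rewrite !expr0 !mulr1.
rewrite -(ler_pM2l t1) (_ : (1 + t) * ((1 + t) * w ^+ n.+1) = ((1 + t) * w) * ((1 + t) * w ^+ n));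
  last by rewrite exprS; ring.
have un0 := exprn_ge0 n u0; have vn0 := exprn_ge0 n v0.
apply: le_trans (ler_pM _ _ wuv IHn) _; rewrite ?mulr_ge0 ?exprn_ge0 ?(ltW t1)//.
have uv : 0 <= t * ((u - v) * (u ^+ n - v ^+ n)).
  apply: mulr_ge0 => //; have [le_uv|lt_vu] := leP u v.
    by rewrite mulr_le0// subr_le0// lerXn2r// nnegrE.
  by rewrite mulr_ge0// subr_ge0 ?(ltW lt_vu)// lerXn2r// ?nnegrE// ltW.
rewrite !exprS; nra.
Qed.

(** Split at [z = delta * y]. Below, the base is at most [4 * y] and the factor [z] supplies the
    small [delta]; above, [y] is at most [z / delta] and only powers of [z] remain. *)
Lemma young_power_le (R : realFieldType) (k : nat) (delta y z : R) :
  0 < delta <= 1 -> 0 <= y -> 0 <= z ->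
  z * (2 * (y + z)) ^+ k <=
  delta * 4 ^+ k * y ^+ k.+1 + (2 + 2 / delta) ^+ k * z ^+ k.+1.
Proof.
move=> /andP[d0 d1] y0 z0.
have M0 : 0 <= 2 * (y + z) by rewrite mulr_ge0// addr_ge0.
have p0 : 0 <= 2 + 2 / delta by rewrite addr_ge0// divr_ge0// ltW.
have [zy|yz] := leP z (delta * y).
  rewrite ler_wpDr ?mulr_ge0 ?exprn_ge0//.
  rewrite (_ : delta * _ * _ = (delta * y) * (4 * y) ^+ k); last first.
    by rewrite exprMn exprS; ring.
  have dy : delta * y <= y by rewrite ler_piMl.
  have M4 : 2 * (y + z) <= 4 * y by lra.
  by apply: ler_pM; rewrite ?exprn_ge0// lerXn2r// nnegrE mulr_ge0.
rewrite ler_wpDl ?mulr_ge0 ?exprn_ge0// ?(ltW d0)//.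
have yz' : y <= z / delta by rewrite ler_pdivlMr// mulrC ltW.
have Mz : 2 * (y + z) <= (2 + 2 / delta) * z.
  rewrite (_ : (2 + 2 / delta) * z = 2 * (z + z / delta)); last by ring.
  lra.
by rewrite exprS mulrCA ler_wpM2l// -exprMn lerXn2r// nnegrE mulr_ge0.
Qed.

(* The symmetric sum cancels the first-order term [s] of the Taylor expansion,
   so that only contributions of order [tau] remain. *)
Lemma symmetric_power_growth (R : realFieldType) (k : nat) (eps : R) : 0 < eps ->
  exists2 C : R, 0 <= C & forall tau y z e s : R, 0 <= tau <= 1 -> 0 <= y -> 0 <= z ->
    0 <= e <= tau * z -> s ^+ 2 <= 4 * (y * e) ->
    (y + s + e) ^+ k.+2 + (y - s + e) ^+ k.+2 <=
      2 * (1 + eps * tau) * y ^+ k.+2 + C * tau * z ^+ k.+2.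
Proof.
move=> eps0; set K : R := k.+2%:R; have K0 : 0 < K by rewrite ltr0n.
pose A : R := 2 * K + 4 * K ^+ 2.
have A0 : 0 < A by rewrite addr_gt0 ?mulr_gt0 ?exprn_gt0.
(* Small enough that the [y]-term of [young_power_le], multiplied by the total constant [A], stays
   within the allowance [2 * eps]. *)
pose delta : R := Num.min 1 (2 * eps / (A * 4 ^+ k.+1)).
have d01 : 0 < delta <= 1.
  by rewrite ge_min lexx andbT lt_min ltr01/= divr_gt0 ?mulr_gt0 ?exprn_gt0.
have dA : A * (delta * 4 ^+ k.+1) <= 2 * eps.
  have : delta <= 2 * eps / (A * 4 ^+ k.+1) by rewrite ge_min lexx orbT.
  rewrite ler_pdivlMr; last by rewrite mulr_gt0 ?exprn_gt0.
  by rewrite (mulrCA delta).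
exists (A * (2 + 2 / delta) ^+ k.+1).
  case/andP: d01 => d0 _.
  by rewrite mulr_ge0 ?(ltW A0)// exprn_ge0// addr_ge0// divr_ge0// ltW.
move=> tau y z e s /andP[t0 t1] y0 z0 /andP[e0 etz] s2.
have ez : e <= z by rewrite (le_trans etz)// ler_piMl.
(* Since [4 * (y * e) <= (y + e) ^+ 2]; hence both bases lie between [0] and [M], as the Taylor
   bound about [y] requires. *)
have sye : `|s| <= y + e.
  rewrite -(@ler_pXn2r _ 2) ?nnegrE ?addr_ge0// real_normK ?num_real//.
  by have := sqr_ge0 (y - e); nra.
have /andP[s1 s1'] : - (y + e) <= s <= y + e by rewrite -ler_norml.
pose M : R := 2 * (y + z).
have M0 : 0 <= M by rewrite mulr_ge0// addr_ge0.
have yM : 0 <= y <= M by rewrite y0 /M; lra.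
have Mk0 : 0 <= M ^+ k by rewrite exprn_ge0.
have b1 : 0 <= y + s + e <= M by rewrite /M; apply/andP; split; lra.
have b2 : 0 <= y - s + e <= M by rewrite /M; apply/andP; split; lra.
apply: le_trans (lerD (taylor_power_le _ k _ _ _ b1 yM) (taylor_power_le _ k _ _ _ b2 yM)) _.
rewrite -/K (_ : y + s + e - y = e + s); last by ring.
rewrite (_ : y - s + e - y = e - s); last by ring.
(* The deviations from [y] are [e + s] and [e - s]. Their sum [2 * e] is of order [tau], and so is
   the sum of their squares because [s ^+ 2 <= 4 * (y * e)]. *)
have sq : (e + s) ^+ 2 + (e - s) ^+ 2 <= 4 * (tau * z) * M.
  rewrite (_ : _ + _ = 2 * s ^+ 2 + 2 * (e * e)); last by ring.
  have h1 : e * y <= tau * z * y by rewrite ler_wpM2r.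
  have h2 : e * e <= tau * z * z by rewrite ler_pM.
  rewrite /M; nra.
have lin : y ^+ k.+1 * e <= M ^+ k.+1 * (tau * z).
  by rewrite ler_pM ?exprn_ge0// lerXn2r ?nnegrE//; case/andP: yM.
have quad : M ^+ k * ((e + s) ^+ 2 + (e - s) ^+ 2) <= 4 * (M ^+ k.+1 * (tau * z)).
  rewrite (_ : 4 * _ = M ^+ k * (4 * (tau * z) * M)); last by rewrite exprS; ring.
  by rewrite ler_wpM2l.
have young := young_power_le _ k.+1 _ _ _ d01 y0 z0.
rewrite -/M in young.
set Q := z * M ^+ k.+1 in young.
have QE : M ^+ k.+1 * (tau * z) = tau * Q by rewrite /Q; ring.
rewrite {}QE in lin quad.
have {}lin : 2 * K * (y ^+ k.+1 * e) <= 2 * K * (tau * Q).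
  by rewrite ler_wpM2l// mulr_ge0// ltW.
have {}quad := ler_wpM2l (sqr_ge0 K) quad.
have {}young : A * tau * Q <=
    A * tau * (delta * 4 ^+ k.+1 * y ^+ k.+2 + (2 + 2 / delta) ^+ k.+1 * z ^+ k.+2).
  by rewrite ler_wpM2l// mulr_ge0// ltW.
have eps_y : A * (delta * 4 ^+ k.+1) * (tau * y ^+ k.+2) <= 2 * eps * (tau * y ^+ k.+2).
  by rewrite ler_wpM2r// mulr_ge0// exprn_ge0.
rewrite (_ : _ + _ + _ = 2 * y ^+ k.+2 + 2 * K * (y ^+ k.+1 * e)
  + K ^+ 2 * (M ^+ k * ((e + s) ^+ 2 + (e - s) ^+ 2))); last by ring.
have AE : A * tau * Q = 2 * K * (tau * Q) + K ^+ 2 * (4 * (tau * Q)) by rewrite /A; ring.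
have -> : 2 * (1 + eps * tau) * y ^+ k.+2 + A * (2 + 2 / delta) ^+ k.+1 * tau * z ^+ k.+2
  = 2 * y ^+ k.+2 + 2 * eps * (tau * y ^+ k.+2)
    + A * tau * ((2 + 2 / delta) ^+ k.+1 * z ^+ k.+2) by ring.
rewrite AE in young.
lra.
Qed.

(** * Euclidean and Hilbert-Schmidt norms *)

Section euclidean.
Context {R : realType} {d : nat}.
Implicit Types (u v w : 'cV[R]_d) (a : R).

Lemma vdotC u v : vdot u v = vdot v u.
Proof. by apply: eq_bigr => i _; rewrite mulrC. Qed.

Lemma vdotDl u v w : vdot (u + v) w = vdot u w + vdot v w.
Proof. by rewrite /vdot -big_split/=; apply: eq_bigr => i _; rewrite mxE mulrDl. Qed.

Lemma vdotZl a u v : vdot (a *: u) v = a * vdot u v.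
Proof. by rewrite /vdot mulr_sumr; apply: eq_bigr => i _; rewrite mxE mulrA. Qed.

Lemma vdotNl u v : vdot (- u) v = - vdot u v.
Proof. by rewrite -scaleN1r vdotZl mulN1r. Qed.

Lemma vdotBl u v w : vdot (u - v) w = vdot u w - vdot v w.
Proof. by rewrite vdotDl vdotNl. Qed.

Lemma vdotDr u v w : vdot u (v + w) = vdot u v + vdot u w.
Proof. by rewrite !(vdotC u) vdotDl. Qed.

Lemma vdotNr u v : vdot u (- v) = - vdot u v.
Proof. by rewrite !(vdotC u) vdotNl. Qed.

Lemma vdotBr u v w : vdot u (v - w) = vdot u v - vdot u w.
Proof. by rewrite vdotDr vdotNr. Qed.

Lemma vdotZr a u v : vdot u (a *: v) = a * vdot u v.
Proof. by rewrite !(vdotC u) vdotZl. Qed.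

Lemma vdot_ge0 u : 0 <= vdot u u.
Proof. by apply: sumr_ge0 => i _; rewrite -expr2 sqr_ge0. Qed.

Lemma vnorm_ge0 u : 0 <= vnorm u. Proof. exact: sqrtr_ge0. Qed.

Lemma vnormE u : vnorm u = Num.sqrt (vdot u u).
Proof. by congr Num.sqrt; apply: eq_bigr => i _; rewrite expr2. Qed.

Lemma sqr_vnorm u : vnorm u ^+ 2 = vdot u u.
Proof. by rewrite vnormE sqr_sqrtr// vdot_ge0. Qed.

Lemma vnorm_le u v : vdot u u <= vdot v v -> vnorm u <= vnorm v.
Proof. by move=> uv; rewrite !vnormE ler_wsqrtr. Qed.

Lemma ler_coord_vnorm u i : `|u i 0| <= vnorm u.
Proof.
rewrite -(@ler_pXn2r _ 2) ?nnegrE ?vnorm_ge0// real_normK ?num_real//.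
rewrite sqr_vnorm /vdot (bigD1 i)//= -expr2 lerDl.
by apply: sumr_ge0 => j _; rewrite -expr2 sqr_ge0.
Qed.

Lemma cauchy_schwarz u v : vdot u v ^+ 2 <= vdot u u * vdot v v.
Proof.
set a := vdot v v; set b := vdot u v.
have [a0|a_gt0|a_eq0] := ltgtP a 0.
- by have := vdot_ge0 v; rewrite -/a leNgt a0.
- have := vdot_ge0 (a *: u - b *: v).
  rewrite vdotBl !vdotBr !vdotZl !vdotZr (vdotC v u) -/a -/b => ge0.
  rewrite -(ler_pM2l a_gt0); nra.
- have v0 i : v i 0 = 0.
    have := ler_coord_vnorm v i.
    by rewrite vnormE -/a a_eq0 sqrtr0 normr_le0 => /eqP.
  rewrite a_eq0 mulr0 /b /vdot big1 ?expr0n// => i _.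
  by rewrite v0 mulr0.
Qed.

Lemma vnormD u v : vnorm (u + v) <= vnorm u + vnorm v.
Proof.
rewrite -(@ler_pXn2r _ 2) ?nnegrE ?addr_ge0 ?vnorm_ge0//.
rewrite sqrrD !sqr_vnorm vdotDl !vdotDr (vdotC v u).
suff : vdot u v <= vnorm u * vnorm v by lra.
apply: le_trans (ler_norm _) _.
rewrite -(@ler_pXn2r _ 2) ?nnegrE ?mulr_ge0 ?vnorm_ge0//.
by rewrite real_normK ?num_real// exprMn !sqr_vnorm cauchy_schwarz.
Qed.

Lemma vnormZ a u : vnorm (a *: u) = `|a| * vnorm u.
Proof. by rewrite !vnormE vdotZl vdotZr mulrA -expr2 sqrtrM ?sqr_ge0// sqrtr_sqr. Qed.

Lemma vnormN u : vnorm (- u) = vnorm u.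
Proof. by rewrite -scaleN1r vnormZ normrN1 mul1r. Qed.

Lemma vnorm_le_sum u : vnorm u <= \sum_(i < d) `|u i 0|.
Proof.
have s0 : 0 <= \sum_(i < d) `|u i 0| by apply: sumr_ge0.
rewrite -(@ler_pXn2r _ 2) ?nnegrE ?vnorm_ge0// sqr_vnorm expr2 mulr_suml.
apply: ler_sum => i _; rewrite -expr2 -real_normK ?num_real// expr2.
by rewrite ler_wpM2l// (bigD1 i)//= lerDl sumr_ge0.
Qed.

Lemma rat_dense_cV u (e : R) : 0 < e ->
  exists q : 'cV[rat]_d, vnorm (u - map_mx ratr q) < e.
Proof.
(* Dividing by [d + 1] keeps the sum of [d] errors strictly below [e], also when [d = 0]. *)
move=> e0; pose h := e / d.+1%:R; have h0 : 0 < h by rewrite divr_gt0.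
have /fin_all_exists [q qP] : forall i, exists q : rat, `|u i 0 - ratr q| < h.
  move=> i; have /rat_in_itvoo[q] : u i 0 - h < u i 0 + h by lra.
  rewrite in_itv/= => /andP[q1 q2]; exists q.
  by rewrite ltr_norml; apply/andP; split; lra.
exists (\col_i q i); apply: le_lt_trans (vnorm_le_sum _) _.
apply: (@le_lt_trans _ _ (\sum_(i < d) h)).
  by apply: ler_sum => i _; rewrite !mxE ltW.
have eE : e = h * d.+1%:R by rewrite /h divfK// pnatr_eq0.
by rewrite sumr_const card_ord -mulr_natr [X in _ < X]eE ltr_pM2l// ltr_nat.
Qed.

End euclidean.

Lemma sqr_hsnorm (R : realType) (d D : nat) (A : 'M[R]_(d, D)) :
  hsnorm A ^+ 2 = \sum_(i < d) \sum_(j < D) A i j ^+ 2.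
Proof.
by rewrite sqr_sqrtr// sumr_ge0// => i _; rewrite sumr_ge0// => j _; rewrite sqr_ge0.
Qed.

Lemma ler_entry_hsnorm (R : realType) (d D : nat) (A : 'M[R]_(d, D)) i j :
  `|A i j| <= hsnorm A.
Proof.
rewrite -(@ler_pXn2r _ 2) ?nnegrE ?sqrtr_ge0// real_normK ?num_real// sqr_hsnorm.
rewrite (bigD1 i)//= (bigD1 j)//= -addrA lerDl addr_ge0 ?sumr_ge0// => k _.
  by rewrite sqr_ge0.
by rewrite sumr_ge0// => l _; rewrite sqr_ge0.
Qed.

Lemma vdot_mulmx_le (R : realType) (d D : nat) (A : 'M[R]_(d, D)) (v : 'cV[R]_D) :
  vdot (A *m v) (A *m v) <= hsnorm A ^+ 2 * vdot v v.
Proof.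
rewrite sqr_hsnorm mulr_suml; apply: ler_sum => i _.
have -> : (A *m v) i 0 = vdot (row i A)^T v.
  by rewrite mxE; apply: eq_bigr => j _; rewrite !mxE.
rewrite -expr2; apply: le_trans (cauchy_schwarz _ _) _.
rewrite ler_wpM2r ?vdot_ge0//; apply: ler_sum => j _.
by rewrite !mxE expr2.
Qed.

(** * Measurability of the scheme *)

(** Here [f] is the pointwise infimum of the [g i], so [f < c] holds exactly on the countable union
    of the sets [g i < c]. *)
Lemma measurable_countable_inf {d : measure_display} {T : measurableType d}
    {R : realType} (I : countType) (f : T -> R) (g : I -> T -> R) :
  (forall i, measurable_fun [set: T] (g i)) -> (forall i w, f w <= g i w) ->
  (forall w e, 0 < e -> exists i, g i w < f w + e) -> measurable_fun [set: T] f.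
Proof.
move=> mg fg gf; apply: (measurability _ (RGenInftyO.measurableE R)) => //.
move=> _ [_ [c ->] <-]; rewrite setTI.
have -> : f @^-1` `]-oo, c[ = \bigcup_i (g i @^-1` `]-oo, c[).
  apply/seteqP; split=> w; rewrite /= in_itv/=.
    rewrite -subr_gt0 => /(gf w)[i]; rewrite subrKC => gi.
    by exists i => //=; rewrite in_itv.
  by move=> [i _] /=; rewrite in_itv/=; exact: le_lt_trans (fg i w).
apply: countable_bigcupT_measurable; first exact: countableP.
by move=> i; rewrite -[X in measurable X]setTI; exact: mg.
Qed.

Section vector_measurability.
Context {R : realType} {dT : measure_display} {T : measurableType dT}.

Lemma measurable_vdot {d : nat} (Y : T -> 'cV[R]_d) :
  (forall i, measurable_fun [set: T] (fun w => Y w i 0)) ->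
  measurable_fun [set: T] (fun w => vdot (Y w) (Y w)).
Proof. by move=> mY; apply: measurable_sum => i; exact: measurable_funM. Qed.

Lemma measurable_vnorm {d : nat} (Y : T -> 'cV[R]_d) :
  (forall i, measurable_fun [set: T] (fun w => Y w i 0)) ->
  measurable_fun [set: T] (fun w => vnorm (Y w)).
Proof.
move=> mY; rewrite (_ : (fun w => _) = fun w => vdot (Y w) (Y w) `^ 2^-1); last first.
  by apply/funext => w; rewrite vnormE powR12_sqrt ?vdot_ge0.
by apply: (measurableT_comp (measurable_powR _)); exact: measurable_vdot.
Qed.

(* McShane's formula [f (X w) = inf_q (f q + C |F (X w) - F q|)] over rational
   [q] shows that [f \o X] is measurable as soon as [F \o X] is. *)
Lemma measurable_lipschitz_along {d : nat} (F : 'cV[R]_d -> 'cV[R]_d)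
    (f : 'cV[R]_d -> R) (C : R) (X : T -> 'cV[R]_d) :
  0 <= C -> (forall u v, `|f u - f v| <= C * vnorm (F u - F v)) ->
  (forall u e, 0 < e -> exists2 delta, 0 < delta &
    forall v, vnorm (u - v) < delta -> vnorm (F u - F v) < e) ->
  (forall i, measurable_fun [set: T] (fun w => F (X w) i 0)) ->
  measurable_fun [set: T] (fun w => f (X w)).
Proof.
move=> C0 fF Fcont mFX.
pose g (q : 'cV[rat]_d) w := let v := map_mx ratr q in
  f v + C * vnorm (F (X w) - F v).
apply: (@measurable_countable_inf _ _ _ _ _ g).
- move=> q; apply: measurable_funD => //; apply: measurable_funM => //.
  apply: measurable_vnorm => i; under eq_fun do rewrite !mxE.
  exact: measurable_funB.
- by move=> q w; rewrite -lerBlDl (le_trans (ler_norm _)).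
(* [f v] exceeds [f (X w)] by at most [C * e'], and the penalty term adds at most another
   [C * e']. *)
move=> w e e0; pose e' := e / (2 * C + 1).
have C1 : 0 < 2 * C + 1 by rewrite ltr_wpDl// mulr_ge0.
have e'0 : 0 < e' by rewrite divr_gt0.
have [delta delta0 Fdelta] := Fcont (X w) e' e'0.
have [q qP] := rat_dense_cV (X w) delta delta0.
exists q; rewrite /g/=; set v := map_mx ratr q in qP *.
have FE := Fdelta v qP.
have eE : e = 2 * C * e' + e' by rewrite /e'; field; rewrite gt_eqF.
have := fF (X w) v; rewrite ler_norml => /andP[h _].
have := ler_wpM2l C0 (ltW FE); rewrite eE; lra.
Qed.

Variables (d D : nat) (b : 'cV[R]_d -> 'cV[R]_d) (sigma : 'cV[R]_d -> 'M[R]_(d, D)).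
Variables (L1 L3 q tau : R).
Hypotheses (L1_ge0 : 0 <= L1) (L3_gt0 : 0 < L3) (q_ge1 : 1 <= q) (tau_ge0 : 0 <= tau).
Hypothesis sigma_lip : forall u v, hsnorm (sigma u - sigma v) <= L1 * vnorm (u - v).
Hypothesis b_diss : forall u v, vdot (u - v) (b u - b v) <= 0.
Hypothesis b_lip : forall u v, vnorm (b u - b v) <=
  L3 * (1 + vnorm u `^ (q - 1) + vnorm v `^ (q - 1)) * vnorm (u - v).

Lemma measurable_diffusion (X : T -> 'cV[R]_d) i j :
  (forall i, measurable_fun [set: T] (fun w => X w i 0)) ->
  measurable_fun [set: T] (fun w => sigma (X w) i j).
Proof.
move=> mX; apply: (@measurable_lipschitz_along _ id (fun u => sigma u i j) L1) => //.
  move=> u v; apply: le_trans (sigma_lip u v).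
  by have := ler_entry_hsnorm _ _ _ (sigma u - sigma v) i j; rewrite !mxE.
by move=> u e e0; exists e.
Qed.

(** Expanding the square on the right, dissipativity makes the cross term nonnegative. Thus each
    coordinate of [u] is a 1-Lipschitz function of [u - tau *: b u]. *)
Lemma implicit_map_expanding u v :
  vnorm (u - v) <= vnorm ((u - tau *: b u) - (v - tau *: b v)).
Proof.
have -> : (u - tau *: b u) - (v - tau *: b v) = (u - v) - tau *: (b u - b v).
  by rewrite scalerBr !opprD addrACA.
apply: vnorm_le; move: (u - v) (b u - b v) (b_diss u v) => z c zc.
rewrite vdotBl !vdotBr !vdotZl !vdotZr (vdotC c z).
have h1 : tau * vdot z c <= 0 by rewrite mulr_ge0_le0.
have h2 : 0 <= tau * (tau * vdot c c) by rewrite !mulr_ge0// vdot_ge0.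
lra.
Qed.

Lemma implicit_map_continuous u (e : R) : 0 < e -> exists2 delta, 0 < delta &
  forall v, vnorm (u - v) < delta ->
    vnorm ((u - tau *: b u) - (v - tau *: b v)) < e.
Proof.
(* [K] bounds the growth of [tau *: b] from [u] to any [v] within distance 1, where
   [vnorm v <= vnorm u + 1]. *)
move=> e0; pose K := tau * (L3 * (1 + vnorm u `^ (q - 1) + (vnorm u + 1) `^ (q - 1))).
have K0 : 0 <= K by rewrite !mulr_ge0 ?(ltW L3_gt0)// !addr_ge0 ?powR_ge0.
have K1 : 0 < 1 + K by rewrite ltr_wpDr.
exists (Num.min 1 (e / (1 + K))); first by rewrite lt_min ltr01 divr_gt0.
move=> v; rewrite lt_min => /andP[uv1]; rewrite ltr_pdivlMr// => uvK.
apply: le_lt_trans uvK; have uv0 := vnorm_ge0 (u - v).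
have -> : (u - tau *: b u) - (v - tau *: b v) = (u - v) + - (tau *: (b u - b v)).
  by rewrite scalerBr !opprD addrACA.
apply: le_trans (vnormD _ _) _; rewrite vnormN vnormZ ger0_norm//.
rewrite mulrDr mulr1 lerD2l [_ * K]mulrC /K -mulrA ler_wpM2l//.
apply: le_trans (b_lip u v) _; rewrite ler_wpM2r// ler_wpM2l ?(ltW L3_gt0)//.
rewrite lerD2l ge0_ler_powR ?nnegrE ?subr_ge0 ?addr_ge0 ?vnorm_ge0//.
have -> : v = u - (u - v) by rewrite opprB subrKC.
by apply: le_trans (vnormD _ _) _; rewrite vnormN lerD2l ltW.
Qed.

(** At [X k.+1] the implicit map equals an explicit function of [X k] and [Z k], from which
    [measurable_lipschitz_along] recovers the coordinates. Measurability is asked only of the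
    increments before [n], so that the lemma also applies to a sigma-algebra carrying just the
    past. *)
Lemma measurable_scheme (n : nat) (x : 'cV[R]_d) (X : nat -> T -> 'cV[R]_d)
    (Z : nat -> T -> 'cV[R]_D) :
  (forall w, X 0%N w = x) ->
  (forall k w, X k.+1 w = X k w + tau *: b (X k.+1 w) + sigma (X k w) *m Z k w) ->
  (forall k i, (k < n)%N -> measurable_fun [set: T] (fun w => Z k w i 0)) ->
  forall k i, (k <= n)%N -> measurable_fun [set: T] (fun w => X k w i 0).
Proof.
move=> X0 XS mZ; elim=> [|k IHk] i kn.
  by under eq_fun do rewrite X0; exact: measurable_cst.
have mX j : measurable_fun [set: T] (fun w => X k w j 0) by apply: IHk; exact: ltnW.
apply: (@measurable_lipschitz_along _ (fun u => u - tau *: b u) (fun u => u i 0) 1) => //.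
- move=> u v; rewrite mul1r; apply: le_trans (implicit_map_expanding u v).
  by have := ler_coord_vnorm (u - v) i; rewrite !mxE.
- exact: implicit_map_continuous.
move=> j; rewrite (_ : (fun w => _) =
    fun w => X k w j 0 + \sum_(l < D) sigma (X k w) j l * Z k w l 0); last first.
  apply/funext => w; have -> : X k.+1 w - tau *: b (X k.+1 w) = X k w + sigma (X k w) *m Z k w.
    by rewrite [X in X - _]XS addrAC addrK.
  by rewrite !mxE.
apply: measurable_funD => //; apply: measurable_sum => l.
by apply: measurable_funM; [exact: measurable_diffusion|exact: mZ].
Qed.

End vector_measurability.

(** * Reflection of the last increment *)

Section reflection.
Import numFieldTopology.Exports.
Context {R : realType} {dT : measure_display} {T : measurableType dT} {D : nat}.
Variables (n : nat) (Z : nat -> T -> 'cV[R]_D).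

(* A point of [T * 'cV_D] carries the past increments in its first component and
   a free value of the [n]-th increment in its second, so that [dW_n] and [- dW_n]
   are compared through two laws on the same space. *)
Definition path_coord (p : 'I_n.+1 * 'I_D) (u : T * 'cV[R]_D) : R :=
  if (p.1 < n)%N then Z p.1 u.1 p.2 0 else u.2 p.2 0.

(** The generated sigma-algebra sees the first component only through the increments before [n]. A
    law on it is determined by its values on these rectangles, which independence turns into
    products. *)
Definition path_rect : set (set (T * 'cV[R]_D)) :=
  [set A | exists2 B : 'I_n.+1 * 'I_D -> set R, (forall p, measurable (B p)) &
    A = \bigcap_(p in [set: 'I_n.+1 * 'I_D]) (path_coord p @^-1` B p)].

Lemma measurable_path_coord p :
  measurable_fun [set: g_sigma_algebraType path_rect] (path_coord p).
Proof.
move=> _ B mB; rewrite setTI; apply: sub_sigma_algebra.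
exists (fun q => if q == p then B else setT); first by move=> q; case: ifP.
apply/seteqP; split=> [u Bu q _ /=|u /(_ p I)] /=; last by rewrite eqxx.
by case: eqP => [->|].
Qed.

Hypothesis mZ : forall k i, measurable_fun [set: T] (fun w => Z k w i 0).

Lemma setI_closed_path_rect : setI_closed path_rect.
Proof.
move=> _ _ [B mB ->] [B' mB' ->]; exists (fun p => B p `&` B' p).
  by move=> p; exact: measurableI.
rewrite -bigcapI; apply: eq_bigcapr => p _; exact: preimage_setI.
Qed.

Lemma path_coord_graph (s : bool) p w :
  path_coord p (w, if s then - Z n w else Z n w) =
  if (p.1 < n)%N || ~~ s then Z p.1 w p.2 0 else - Z p.1 w p.2 0.
Proof.
rewrite /path_coord /=; case: ifP => //= pn.
have -> : (p.1 : nat) = n.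
  by apply/eqP; rewrite eqn_leq -ltnS ltn_ord leqNgt pn.
by case: s => //=; rewrite mxE.
Qed.

Lemma measurable_graph (s : bool) : measurable_fun [set: T]
  ((fun w => (w, if s then - Z n w else Z n w)) : T -> g_sigma_algebraType path_rect).
Proof.
apply: (@measurability _ _ T (g_sigma_algebraType path_rect) _ _ path_rect) => //.
move=> _ [_ [B mB ->] <-]; rewrite setTI preimage_bigcap.
apply: fin_bigcap_measurable; first exact: finite_finset.
move=> p _; rewrite -comp_preimage.
rewrite (_ : _ \o _ = fun w => if (p.1 < n)%N || ~~ s then Z p.1 w p.2 0 else - Z p.1 w p.2 0);
  last by apply/funext => w; rewrite /= path_coord_graph.
rewrite -[X in measurable X]setTI.
case: ((p.1 < n)%N || ~~ s) => //; first exact: mZ.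
by apply: measurableT_comp => //; exact: mZ.
Qed.

Variable P : probability T R.
Hypothesis Zindep : mutually_independent P
  (fun p : 'I_n.+1 * 'I_D => fun w => Z p.1 w p.2 0).
Hypothesis Zsym : forall i (B : set R), measurable B ->
  P ((fun w => - Z n w i 0) @^-1` B) = P ((fun w => Z n w i 0) @^-1` B).

(** The two integrals are taken against the laws of [(w, - Z n w)] and [(w, Z n w)]. These agree on
    rectangles by independence and symmetry, hence on the whole sigma-algebra by uniqueness on a
    pi-system. *)
Lemma reflect_last_increment (f : T * 'cV[R]_D -> R) :
  measurable_fun [set: g_sigma_algebraType path_rect] f -> (forall u, 0 <= f u) ->
  (\int[P]_w (f (w, - Z n w))%:E = \int[P]_w (f (w, Z n w))%:E)%E.
Proof.
move=> mf f0.
pose graph (s : bool) (w : T) : g_sigma_algebraType path_rect :=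
  (w, if s then - Z n w else Z n w).
have pushE s : (\int[pushforward P (graph s)]_u (f u)%:E =
    \int[P]_w (f (graph s w))%:E)%E.
  rewrite ge0_integral_pushforward//; first exact: measurable_graph.
    exact/measurable_EFinP.
  by move=> u _; rewrite lee_fin.
rewrite -(pushE true) -(pushE false).
have mG s : measurable_fun [set: T] (graph s) := measurable_graph s.
apply: eq_measure_integral; try exact: mG.
move=> A mA _.
apply: (@g_sigma_algebra_measure_unique _ R (g_sigma_algebraType path_rect)
  path_rect _ (fun=> setT) _ _ _ _ _ _ _ A mA) => //.
- exact: sub_sigma_algebra.
- by move=> _; exists (fun=> setT) => //; rewrite bigcapT.
- by apply/seteqP; split => // u _; exists 0%N.
- exact: setI_closed_path_rect.
- move=> _ [B mB ->].
  (* The reflection is moved from the path to the sets: on the coordinates of the last increment,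
     [B p] becomes its mirror image, which has the same probability. *)
  pose C s (p : 'I_n.+1 * 'I_D) := if (p.1 < n)%N || ~~ s then B p else -%R @^-1` B p.
  have mC s p : measurable (C s p).
    rewrite /C; case: ifP => // _; rewrite -[X in measurable X]setTI.
    exact: oppr_measurable.
  have rectE s : graph s @^-1`
      (\bigcap_(p in [set: 'I_n.+1 * 'I_D]) (path_coord p @^-1` B p)) =
      \bigcap_(p in [set: 'I_n.+1 * 'I_D]) ((fun w => Z p.1 w p.2 0) @^-1` C s p).
    rewrite preimage_bigcap; apply: eq_bigcapr => p _; apply/seteqP.
    by split=> w; rewrite /= path_coord_graph /C; case: ifP.
  have probE s : P (graph s @^-1`
        (\bigcap_(p in [set: 'I_n.+1 * 'I_D]) (path_coord p @^-1` B p))) =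
      (\prod_(p : 'I_n.+1 * 'I_D) P ((fun w => Z p.1 w p.2 0%R) @^-1` B p))%E.
    rewrite rectE Zindep//; apply: eq_bigr => p _; rewrite /C.
    case: ltnP => //= np; case: s => //=.
    have -> : (p.1 : nat) = n by apply/eqP; rewrite eqn_leq np -ltnS ltn_ord.
    exact: Zsym.
  exact: etrans (probE true) (esym (probE false)).
- by move=> k; rewrite -[X in (X < _)%E]/(P setT) probability_setT ltry.
Qed.

End reflection.

(** * Gaussian moments *)

Section normal_moments.
Context {R : realType}.
Local Notation mu := (@lebesgue_measure R).

(** The Radon-Nikodym derivative and the Gaussian density have equal integrals over every measurable
    set, so they agree almost everywhere and can be exchanged under the integral. *)
Lemma ge0_integral_normal_prob (m s : R) (f : R -> \bar R) :
  measurable_fun [set: R] f -> (forall x, 0 <= f x)%E ->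
  (\int[normal_prob m s]_x f x = \int[mu]_x (f x * (normal_pdf m s x)%:E))%E.
Proof.
move=> mf f0; have dom := normal_prob_dominates m s.
have mpdf : measurable_fun [set: R] (fun x => (normal_pdf m s x)%:E).
  by apply/measurable_EFinP; exact: measurable_normal_pdf.
have mRN := measurable_int _ (Radon_Nikodym_SigmaFinite.f_integrable dom).
rewrite -(Radon_Nikodym_SigmaFinite.change_of_variables dom f0)//.
apply: ge0_ae_eq_integral => //.
- exact: emeasurable_funM.
- exact: emeasurable_funM.
- by move=> x _; rewrite mule_ge0// Radon_Nikodym_SigmaFinite.f_ge0.
- by move=> x _; rewrite mule_ge0// lee_fin normal_pdf_ge0.
apply: ae_eqe_mul2l; apply: integral_ae_eq => //.
  exact: Radon_Nikodym_SigmaFinite.f_integrable.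
by move=> A _ mA; rewrite -Radon_Nikodym_SigmaFinite.f_integral.
Qed.

Lemma normal_prob_oppr (s : R) (B : set R) : s != 0 -> measurable B ->
  normal_prob 0 s (-%R @^-1` B) = normal_prob 0 s B.
Proof.
move=> s0 mB; rewrite /normal_prob.
have pdfN x : normal_pdf 0 s (- x) = normal_pdf 0 s x.
  by rewrite normal_pdfE// /normal_fun !subr0 sqrrN.
transitivity (\int[pushforward mu (-%R : _ -> measurableTypeR R)]_(x in B)
    (normal_pdf 0 s x)%:E)%E.
  rewrite ge0_integral_pushforward//=.
  - by apply: eq_integral => x _; rewrite /= pdfN.
  - by apply/measurable_EFinP/measurable_funTS; exact: measurable_normal_pdf.
  - by move=> x _; rewrite lee_fin normal_pdf_ge0.
by apply: eq_measure_integral => //= A mA _; exact: lebesgue_measureN.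
Qed.

(* [x^k <= 4^k k! exp (x / 4)], and multiplying the density of variance [s^2]
   by [exp (x^2 / (4 s^2))] gives a multiple of the density of variance
   [2 s^2]. *)
Lemma normal_moment_le (k : nat) : exists2 C : R, 0 <= C & forall s : R, 0 < s ->
  (\int[normal_prob 0 s]_x ((x ^+ 2 / s ^+ 2) ^+ k)%:E <= C%:E)%E.
Proof.
(* The factor [Num.sqrt 2] is the ratio of the peaks of the densities with deviations [s] and
   [Num.sqrt 2 * s]. *)
pose c : R := 4 ^+ k * k`!%:R * Num.sqrt 2.
exists c => [|s s0]; first by rewrite !mulr_ge0 ?exprn_ge0 ?sqrtr_ge0.
have s20 : 0 < s ^+ 2 by rewrite exprn_gt0.
have r2 : 0 < Num.sqrt 2 :> R by rewrite sqrtr_gt0.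
have r0 : 0 < Num.sqrt 2 * s by rewrite mulr_gt0.
have rE : (Num.sqrt 2 * s) ^+ 2 = 2 * s ^+ 2 by rewrite exprMn sqr_sqrtr.
rewrite ge0_integral_normal_prob; last 2 first.
- apply/measurable_EFinP; apply: measurable_funX.
  by apply: measurable_funM => //; exact: measurable_funX.
- by move=> x; rewrite lee_fin exprn_ge0// divr_ge0 ?sqr_ge0.
have -> : c%:E = (\int[mu]_x (c%:E * (normal_pdf 0 (Num.sqrt 2 * s) x)%:E))%E.
  rewrite ge0_integralZl ?integral_normal_pdf ?mule1//.
  - by apply/measurable_EFinP; exact: measurable_normal_pdf.
  - by move=> x _; rewrite lee_fin normal_pdf_ge0.
  - by rewrite lee_fin !mulr_ge0 ?exprn_ge0 ?sqrtr_ge0.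
apply: ge0_le_integral => //.
- move=> x _; rewrite -EFinM lee_fin mulr_ge0 ?normal_pdf_ge0//.
  by rewrite exprn_ge0// divr_ge0 ?sqr_ge0.
- apply: emeasurable_funM; apply/measurable_EFinP; last exact: measurable_normal_pdf.
  apply: measurable_funX.
  by apply: measurable_funM => //; exact: measurable_funX.
- apply: emeasurable_funM => //.
  by apply/measurable_EFinP; exact: measurable_normal_pdf.
move=> x _; rewrite -!EFinM lee_fin !normal_pdfE ?gt_eqF// /normal_fun !subr0 rE.
set y := x ^+ 2 / s ^+ 2.
have y0 : 0 <= y by rewrite divr_ge0 ?sqr_ge0.
have yk : y ^+ k <= 4 ^+ k * k`!%:R * expR (y / 4).
  have y40 : 0 <= y / 4 by rewrite divr_ge0.
  have : (y / 4) ^+ k <= k`!%:R * expR (y / 4).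
    case: k {c} => [|k]; first by rewrite expr0 fact0 mul1r; have := expR_ge1Dx (y / 4); lra.
    have := expR_ge1Dxn k y40; rewrite -ler_pdivrMl ?ltr0n ?fact_gt0//.
    by rewrite mulrC; lra.
  rewrite expr_div_n ler_pdivrMr ?exprn_gt0// => /le_trans; apply.
  by rewrite mulrC mulrA.
have e1 : expR (- x ^+ 2 / (s ^+ 2 *+ 2)) = expR (- (y / 2)).
  by congr expR; rewrite /y; field; rewrite gt_eqF.
have e2 : expR (- x ^+ 2 / (2 * s ^+ 2 *+ 2)) = expR (y / 4) * expR (- (y / 2)).
  by rewrite -expRD; congr expR; rewrite /y; field; rewrite gt_eqF.
have pk : normal_peak s = Num.sqrt 2 * normal_peak (Num.sqrt 2 * s).
  rewrite /normal_peak rE.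
  have -> : 2 * s ^+ 2 * pi *+ 2 = 2 * (s ^+ 2 * pi *+ 2) :> R by ring.
  by rewrite sqrtrM// invfM mulrA divff ?mul1r// gt_eqF.
rewrite e1 e2 pk /c.
set a := expR (y / 4) in yk *; set b := expR (- (y / 2)).
set pp := normal_peak (Num.sqrt 2 * s).
rewrite (_ : 4 ^+ k * _ * _ * _ = 4 ^+ k * k`!%:R * a * (Num.sqrt 2 * pp * b)); last by ring.
rewrite ler_wpM2r// !mulr_ge0 ?sqrtr_ge0 ?normal_peak_ge0//; exact: expR_ge0.
Qed.

End normal_moments.

(** * Moments of the scheme *)

(** Each term is at most the largest one, whose power is itself one of the summands on the right. *)
Lemma sum_power_le (R : realDomainType) (D k : nat) (y : 'I_D -> R) :
  (forall i, 0 <= y i) ->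
  (\sum_(i < D) y i) ^+ k.+1 <= D%:R ^+ k.+1 * \sum_(i < D) y i ^+ k.+1.
Proof.
case: D y => [|D] y y0; first by rewrite !big_ord0 mulr0 expr0n.
have [m _ ymax] := @arg_maxP _ _ _ ord0 predT y isT.
have sum_le : \sum_(i < D.+1) y i <= D.+1%:R * y m.
  apply: (@le_trans _ _ (\sum_(i < D.+1) y m)).
    by apply: ler_sum => i _; exact: ymax.
  by rewrite sumr_const card_ord mulr_natl.
apply: (@le_trans _ _ ((D.+1%:R * y m) ^+ k.+1)).
  by rewrite lerXn2r ?nnegrE ?sumr_ge0// mulr_ge0.
rewrite exprMn ler_wpM2l ?exprn_ge0// (bigD1 m)//= lerDl.
by rewrite sumr_ge0// => i _; rewrite exprn_ge0.
Qed.

(** * Pathwise estimates for one step *)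

Section scheme_steps.
Context {R : realType} {d : nat}.
Implicit Types (u y a h : 'cV[R]_d).

(** Test the equation against [u] and use dissipativity between [u] and [0]; Young's inequality
    spends half of the dissipation on [b 0]. The remainder carries the weight [c * tau], the form
    that [power_weighted_mean_le] takes. *)
Lemma implicit_step_le (b : 'cV[R]_d -> 'cV[R]_d) (c tau : R) u y :
  0 < c -> 0 <= tau -> vdot (u - 0) (b u - b 0) <= - c * vdot (u - 0) (u - 0) ->
  u = y + tau *: b u ->
  (1 + c * tau) * vdot u u <= vdot y y + c * tau * (vdot (b 0) (b 0) / c ^+ 2).
Proof.
move=> c0 t0; rewrite subr0 vdotBr => diss uE.
have uuE : vdot u u = vdot u y + tau * vdot u (b u).
  by rewrite {2}uE vdotDr vdotZr.
have h1 : 2 * vdot u y <= vdot u u + vdot y y.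
  by have := vdot_ge0 (u - y); rewrite vdotBl !vdotBr (vdotC y u); lra.
have h2 : 2 * vdot u (b 0) <= c * vdot u u + vdot (b 0) (b 0) / c.
  have := vdot_ge0 (c *: u - b 0); rewrite vdotBl !vdotBr !vdotZl !vdotZr (vdotC (b 0)).
  move=> h; rewrite -(ler_pM2l c0) mulrDr [c * (_ / c)]mulrC divfK ?gt_eqF//; lra.
have h3 := ler_wpM2l t0 diss.
have h4 := ler_wpM2l t0 h2.
have -> : c * tau * (vdot (b 0) (b 0) / c ^+ 2) = tau * (vdot (b 0) (b 0) / c).
  by field; rewrite gt_eqF.
lra.
Qed.

(** This is [symmetric_power_growth] for the squared norms of [a + h] and [a - h], with
    [s = 2 * vdot a h]; its condition on [s] is the Cauchy-Schwarz inequality. *)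
Lemma symmetric_step_le (k : nat) (eps : R) : 0 < eps ->
  exists2 C : R, 0 <= C & forall (tau z : R) a h, 0 <= tau <= 1 -> 0 <= z ->
    vdot h h <= tau * z ->
    vdot (a + h) (a + h) ^+ k.+2 + vdot (a - h) (a - h) ^+ k.+2 <=
      2 * (1 + eps * tau) * vdot a a ^+ k.+2 + C * tau * z ^+ k.+2.
Proof.
move=> /(symmetric_power_growth _ k)[C C0 growth]; exists C => //.
move=> tau z a h tau01 z0 hz.
have := growth tau (vdot a a) z (vdot h h) (2 * vdot a h) tau01 (vdot_ge0 a) z0.
rewrite vdot_ge0 hz => /(_ isT).
rewrite (_ : (2 * vdot a h) ^+ 2 = 4 * vdot a h ^+ 2); last by ring.
rewrite ler_pM2l// => /(_ (cauchy_schwarz a h)).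
rewrite !vdotDl !vdotNl !vdotDr !vdotNr (vdotC h a).
rewrite (_ : _ + _ + (_ + vdot h h) = vdot a a + 2 * vdot a h + vdot h h); last by ring.
by rewrite (_ : _ - _ - (_ - vdot h h) = vdot a a - 2 * vdot a h + vdot h h); last by ring.
Qed.

End scheme_steps.

Section integral_bounds.
Context {R : realType} {dT : measure_display} {T : measurableType dT}
  (P : probability T R).

(** Nonnegativity replaces integrability, so no finiteness has to be known beforehand; the constant
    [c] integrates to itself against a probability. *)
Lemma integral_affine_le (f g h : T -> R) (a b c G H : R) :
  measurable_fun [set: T] f -> measurable_fun [set: T] g -> measurable_fun [set: T] h ->
  (forall w, 0 <= f w) -> (forall w, 0 <= g w) -> (forall w, 0 <= h w) ->
  0 <= a -> 0 <= b -> 0 <= c ->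
  (forall w, f w <= a * g w + b * h w + c) ->
  (\int[P]_w (g w)%:E <= G%:E)%E -> (\int[P]_w (h w)%:E <= H%:E)%E ->
  (\int[P]_w (f w)%:E <= (a * G + b * H + c)%:E)%E.
Proof.
move=> mf mg mh f0 g0 h0 a0 b0 c0 fle gG hH.
have mag : measurable_fun [set: T] (fun w => (a * g w)%:E).
  by apply/measurable_EFinP; exact: measurable_funM.
have mbh : measurable_fun [set: T] (fun w => (b * h w)%:E).
  by apply/measurable_EFinP; exact: measurable_funM.
have ag0 w : (0 <= (a * g w)%:E)%E by rewrite lee_fin mulr_ge0.
have bh0 w : (0 <= (b * h w)%:E)%E by rewrite lee_fin mulr_ge0.
apply: (@le_trans _ _ (\int[P]_w ((a * g w)%:E + (b * h w)%:E + c%:E))%E).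
  apply: ge0_le_integral => //.
  - by move=> w _; rewrite lee_fin.
  - exact/measurable_EFinP.
  - by apply: emeasurable_funD => //; exact: emeasurable_funD.
  - by move=> w _; rewrite -!EFinD lee_fin.
rewrite ge0_integralD//; last 2 first.
- by move=> w _; rewrite adde_ge0.
- exact: emeasurable_funD.
rewrite ge0_integralD// integral_cst// [X in (c%:E * X)%E]probability_setT mule1.
under eq_integral do rewrite EFinM.
under [in X in (_ + X + _)%E]eq_integral do rewrite EFinM.
rewrite !ge0_integralZl//; try exact/measurable_EFinP; last 2 first.
- by move=> w _; rewrite lee_fin.
- by move=> w _; rewrite lee_fin.
by rewrite !EFinD !EFinM leeD2r// leeD// lee_wpmul2l.
Qed.

End integral_bounds.

(** Dividing by [tau] normalises the variance, so [m] can be fixed before the space and the step;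
    [sum_power_le] reduces the norm to one-dimensional moments. *)
Lemma gaussian_norm_moment_le (R : realType) (D k : nat) : exists2 m : R, 0 <= m &
  forall (dT : measure_display) (T : measurableType dT) (P : probability T R)
    (tau : R) (Z : T -> 'cV[R]_D), 0 < tau ->
    (forall i, measurable_fun [set: T] (fun w => Z w i 0)) ->
    (forall i (B : set R), measurable B ->
      P ((fun w => Z w i 0) @^-1` B) = normal_prob 0 (Num.sqrt tau) B) ->
    (\int[P]_w ((vdot (Z w) (Z w) / tau) ^+ k.+1)%:E <= m%:E)%E.
Proof.
have [C C0 normC] := @normal_moment_le R k.+1.
exists (D%:R ^+ k.+1 * (D%:R * C)); first by rewrite !mulr_ge0 ?exprn_ge0.
move=> dT T P tau Z tau0 mZ lawZ.
have mY i : measurable_fun [set: T] (fun w => ((Z w i 0 ^+ 2 / tau) ^+ k.+1)%:E).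
  apply/measurable_EFinP; apply: measurable_funX; apply: measurable_funM => //.
  exact: measurable_funX.
have Y0 i w : 0 <= (Z w i 0 ^+ 2 / tau) ^+ k.+1.
  by rewrite exprn_ge0// divr_ge0 ?sqr_ge0// ltW.
apply: (@le_trans _ _ (\int[P]_w ((D%:R ^+ k.+1)%:E *
    \sum_(i < D) ((Z w i 0 ^+ 2 / tau) ^+ k.+1)%:E))%E).
  apply: ge0_le_integral => //.
  - by move=> w _; rewrite lee_fin exprn_ge0// divr_ge0 ?vdot_ge0// ltW.
  - apply/measurable_EFinP; apply: measurable_funX; apply: measurable_funM => //.
    exact: measurable_vdot.
  - by apply: emeasurable_funM => //; exact: emeasurable_sum.
  move=> w _; rewrite sumEFin -EFinM lee_fin.
  rewrite (_ : vdot _ _ / tau = \sum_(i < D) Z w i 0 ^+ 2 / tau).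
    by apply: sum_power_le => i; rewrite divr_ge0 ?sqr_ge0// ltW.
  by rewrite /vdot mulr_suml; apply: eq_bigr => i _; rewrite expr2.
rewrite ge0_integralZl//; last 2 first.
- exact: emeasurable_sum.
- by move=> w _; apply: sume_ge0 => i _; rewrite lee_fin.
rewrite ge0_integral_sum//; last by move=> i w _; rewrite lee_fin.
rewrite EFinM lee_wpmul2l ?lee_fin ?exprn_ge0//.
apply: (@le_trans _ _ (\sum_(i < D) C%:E)%E); last first.
  by rewrite sumEFin sumr_const card_ord mulr_natl.
apply: lee_sum => i _; apply: le_trans (normC (Num.sqrt tau) _); last by rewrite sqrtr_gt0.
rewrite sqr_sqrtr ?(ltW tau0)//.
pose Zi : T -> measurableTypeR R := fun w => Z w i 0.
have mZi : measurable_fun [set: T] Zi := mZ i.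
have mq : measurable_fun [set: measurableTypeR R] (fun y => ((y ^+ 2 / tau) ^+ k.+1)%:E).
  by apply/measurable_EFinP; apply: measurable_funX; exact: measurable_funM.
have <- : (\int[pushforward P Zi]_y ((y ^+ 2 / tau) ^+ k.+1)%:E =
  \int[P]_w ((Z w i 0 ^+ 2 / tau) ^+ k.+1)%:E)%E.
  rewrite (ge0_integral_pushforward mZi P measurableT mq)//.
  by move=> y _; rewrite lee_fin exprn_ge0// divr_ge0 ?sqr_ge0// ltW.
rewrite le_eqVlt; apply/orP; left; apply/eqP.
apply: eq_measure_integral => // A mA _; exact: lawZ.
Qed.

(** * Uniform bound on the even moments *)

Section moment_bound.
Import numFieldTopology.Exports.

(** [K] is fixed before the space, the step and the start, and [x] enters additively: the same bound
    then reproduces itself under one step of the scheme. The exponent is at least 2, as the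
    second-order Taylor bound demands. *)
Lemma even_moment_bound (R : realType) (d D : nat)
  (b : 'cV[R]_d -> 'cV[R]_d) (sigma : 'cV[R]_d -> 'M[R]_(d, D))
  (L1 L2 c L3 q : R) (k : nat) :
  0 <= L1 -> 0 <= L2 ->
  (forall u1 u2, hsnorm (sigma u1 - sigma u2) <= L1 * vnorm (u1 - u2)) ->
  (forall u, hsnorm (sigma u) <= L2) -> 0 < c -> 0 < L3 -> 1 <= q ->
  (forall u1 u2, vdot (u1 - u2) (b u1 - b u2) <= - c * vdot (u1 - u2) (u1 - u2)) ->
  (forall u1 u2, vnorm (b u1 - b u2) <=
      L3 * (1 + vnorm u1 `^ (q - 1) + vnorm u2 `^ (q - 1)) * vnorm (u1 - u2)) ->
  exists2 K : R, 0 <= K &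
    forall (dT : measure_display) (T : measurableType dT) (P : probability T R)
      (tau : R) (Z : nat -> T -> 'cV[R]_D), 0 < tau -> tau <= 1 ->
    (forall n i, measurable_fun [set: T] (fun w => Z n w i 0)) ->
    (forall n, mutually_independent P
       (fun p : 'I_n.+1 * 'I_D => fun w => Z p.1 w p.2 0)) ->
    (forall n i (B : set R), measurable B ->
       P ((fun w => Z n w i 0) @^-1` B) = normal_prob 0 (Num.sqrt tau) B) ->
    forall (x : 'cV[R]_d) (X : nat -> T -> 'cV[R]_d),
      (forall w, X 0%N w = x) ->
      (forall n w, X n.+1 w =
          X n w + tau *: b (X n.+1 w) + sigma (X n w) *m Z n w) ->
    forall n, (\int[P]_w (vdot (X n w) (X n w) ^+ k.+2)%:E <=
      (vdot x x ^+ k.+2 + K)%:E)%E.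
Proof.
move=> L1_ge0 L2_ge0 sigma_lip sigma_bd c0 L3_gt0 q_ge1 b_mon b_lip.
have c20 : 0 < c / 2 by rewrite divr_gt0.
(* Growth at rate [c / 2] uses up only half of the contraction rate [c] of the implicit step. *)
have [C C0 sym_step] := @symmetric_step_le R d k (c / 2) c20.
have [m m0 Zmoment] := gaussian_norm_moment_le R D k.+1.
pose l := (L2 ^+ 2) ^+ k.+2.
have l0 : 0 <= l by rewrite !exprn_ge0.
pose B := (vdot (b 0) (b 0) / c ^+ 2) ^+ k.+2.
have B0 : 0 <= B by rewrite exprn_ge0// divr_ge0 ?vdot_ge0// sqr_ge0.
(* Chosen so that [c * tau * K = C * tau * l * m + 2 * (c * tau * B)]: the remaining half of the
   contraction then pays for the noise and for [b 0]. *)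
pose K := C * l * m / c + 2 * B.
have K0 : 0 <= K.
  apply: addr_ge0; last by rewrite mulr_ge0.
  by apply: divr_ge0; [apply: mulr_ge0 => //; exact: mulr_ge0|exact: ltW].
exists K => // dT T P tau Z tau0 tau1 mZ indepZ lawZ x X X0 XS.
have tau01 : 0 <= tau <= 1 by rewrite tau1 (ltW tau0).
have b_diss u v : vdot (u - v) (b u - b v) <= 0.
  by apply: le_trans (b_mon u v) _; rewrite mulNr oppr_le0 mulr_ge0 ?vdot_ge0// ltW.
have mX n i : measurable_fun [set: T] (fun w => X n w i 0).
  by apply: (measurable_scheme _ _ b sigma L1 L3 q tau _ _ _ _ _ _ _ n x X Z) => //; exact: ltW.
pose V (v : 'cV[R]_d) := vdot v v ^+ k.+2.
have V0 v : 0 <= V v by rewrite exprn_ge0// vdot_ge0.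
have mV d' (S : measurableType d') (Y : S -> 'cV[R]_d) :
    (forall i, measurable_fun [set: S] (fun w => Y w i 0)) ->
    measurable_fun [set: S] (fun w => V (Y w)).
  by move=> mY; apply: measurable_funX; exact: measurable_vdot.
(* The space [S] is arbitrary because this is applied both on [T] and on the path space, where [U]
   is the free second component. *)
have mdrift d' (S : measurableType d') (Y : S -> 'cV[R]_d) (U : S -> 'cV[R]_D) :
    (forall i, measurable_fun [set: S] (fun w => Y w i 0)) ->
    (forall i, measurable_fun [set: S] (fun w => U w i 0)) ->
    measurable_fun [set: S] (fun w => V (Y w + sigma (Y w) *m U w)).
  move=> mY mU; apply: mV => i.
  rewrite (_ : (fun w => _) =
    fun w => Y w i 0 + \sum_(j < D) sigma (Y w) i j * U w j 0); last first.
    by apply/funext => w; rewrite !mxE.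
  apply: measurable_funD => //; apply: measurable_sum => j.
  by apply: measurable_funM => //; exact: measurable_diffusion sigma_lip _ _ _ mY.
elim=> [|n IHn].
  under eq_integral do rewrite X0.
  by rewrite integral_cst// [X in (_ * X)%E]probability_setT mule1 lee_fin lerDl.
set M := vdot x x ^+ k.+2 + K in IHn *.
have MK : K <= M by rewrite lerDr exprn_ge0// vdot_ge0.
pose U s w := V (X n w + sigma (X n w) *m (if s then - Z n w else Z n w)).
have mU s : measurable_fun [set: T] (U s).
  case: s; apply: mdrift => // i; under eq_fun do rewrite mxE.
  exact: measurableT_comp.
have reflect : (\int[P]_w (U true w)%:E = \int[P]_w (U false w)%:E)%E.
  pose G := path_rect n Z.
  pose f (u : T * 'cV[R]_D) := V (X n u.1 + sigma (X n u.1) *m u.2).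
  apply: (reflect_last_increment n Z _ P (indepZ n) _ f) => //.
  - move=> i A mA; rewrite lawZ//.
    rewrite -normal_prob_oppr//; last by rewrite gt_eqF// sqrtr_gt0.
    apply: (lawZ n i (-%R @^-1` A)).
    by rewrite -[X in measurable X]setTI; exact: oppr_measurable.
  (* The scheme is run again over the path sigma-algebra: up to time [n] it reads only past
     increments, which are path coordinates. This is where adaptedness of [X n] enters. *)
  - have mpast j i : (j <= n)%N ->
        measurable_fun [set: g_sigma_algebraType G] (fun u => X j u.1 i 0).
      apply: (measurable_scheme _ _ b sigma L1 L3 q tau _ _ _ _ _ _ _ n x
        (fun j (u : g_sigma_algebraType G) => X j u.1)
        (fun j (u : g_sigma_algebraType G) => Z j u.1)) => //; first exact: ltW.
      move=> l' i' ln.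
      have := measurable_path_coord n Z (Ordinal (ltnW ln : l' < n.+1)%N, i').
      by congr measurable_fun; apply/funext => u; rewrite /path_coord/= ln.
    apply: mdrift => i; first exact: mpast.
    have := measurable_path_coord n Z (ord_max, i).
    by congr measurable_fun; apply/funext => u; rewrite /path_coord/= ltnn.
  - by move=> u; exact: V0.
have Ubound : (\int[P]_w (U false w)%:E <=
    ((1 + c / 2 * tau) * M + C * tau * l * m / 2)%:E)%E.
  (* Both signs are estimated together, where the linear term cancels; [reflect] then yields half of
     the bound for one sign. *)
  have sumU : (\int[P]_w (U false w + U true w)%:E <=
      (2 * (1 + c / 2 * tau) * M + C * tau * l * m + 0)%:E)%E.
    apply: (integral_affine_le P _ (fun w => V (X n w))
      (fun w => (vdot (Z n w) (Z n w) / tau) ^+ k.+2)) => //.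
    - exact: measurable_funD.
    - exact: mV.
    - apply: measurable_funX; apply: measurable_funM => //; exact: measurable_vdot.
    - by move=> w; apply: addr_ge0; exact: V0.
    - by move=> w; rewrite exprn_ge0// divr_ge0 ?vdot_ge0// ltW.
    - by apply: mulr_ge0 => //; apply: addr_ge0 => //; apply: mulr_ge0; exact: ltW.
    - by apply: mulr_ge0 => //; apply: mulr_ge0 => //; exact: ltW.
    - move=> w; rewrite addr0 /U mulmxN.
      pose z := L2 ^+ 2 * (vdot (Z n w) (Z n w) / tau).
      have z0 : 0 <= z by rewrite mulr_ge0 ?sqr_ge0// divr_ge0 ?vdot_ge0// ltW.
      have -> : C * tau * l * (vdot (Z n w) (Z n w) / tau) ^+ k.+2 = C * tau * z ^+ k.+2.
        by rewrite /z /l [in RHS]exprMn; ring.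
      apply: sym_step => //; apply: le_trans (vdot_mulmx_le _ _ _ _ _) _.
      rewrite /z mulrCA [tau * _]mulrC divfK ?gt_eqF// ler_wpM2r ?vdot_ge0//.
      by rewrite lerXn2r ?nnegrE ?sqrtr_ge0// (le_trans (sqrtr_ge0 _) (sigma_bd 0)).
    - by apply: Zmoment => // i A mA; exact: lawZ.
  move: sumU; under eq_integral do rewrite EFinD.
  rewrite ge0_integralD//; try exact/measurable_EFinP; last 2 first.
  - by move=> w _; rewrite lee_fin; exact: V0.
  - by move=> w _; rewrite lee_fin; exact: V0.
  (* Halving requires a finite integral: the bound on the sum excludes [+oo]. *)
  rewrite reflect; case: (integral _ _ _) => [I| |] /=.
  - by rewrite -EFinD !lee_fin; lra.
  - by rewrite addye// !leye_eq.
  - by move=> _; rewrite leNye.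
pose a := (1 + c * tau)^-1.
have ct0 : 0 < 1 + c * tau by rewrite addr_gt0// mulr_gt0.
have a0 : 0 <= a by rewrite invr_ge0 ltW.
(* The zero term only fills the second slot of [integral_affine_le]. *)
have step w : V (X n.+1 w) <= a * U false w + 0 * V (X n w) + a * (c * tau * B).
  rewrite mul0r addr0 -mulrDr /a mulrC ler_pdivlMr// mulrC.
  have beta0 : 0 <= vdot (b 0) (b 0) / c ^+ 2 by rewrite divr_ge0 ?vdot_ge0 ?sqr_ge0.
  apply: power_weighted_mean_le; rewrite ?vdot_ge0//.
    by apply: mulr_ge0; exact: ltW.
  apply: implicit_step_le => //; first exact: ltW.
  by rewrite addrAC -XS.
apply: le_trans (integral_affine_le P _ _ _ _ _ _ _ _ _ _ _ _ _ _ _ _ _ step Ubound IHn) _ => //.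
- exact: mV.
- exact: mV.
- by move=> w; exact: V0.
- by apply: mulr_ge0 => //; apply: mulr_ge0 => //; apply: mulr_ge0; exact: ltW.
rewrite mul0r addr0 -mulrDr lee_fin /a mulrC ler_pdivrMr//.
have := ler_wpM2l (mulr_ge0 (ltW c0) (ltW tau0)) MK.
have : c * tau * K = C * tau * l * m + 2 * (c * tau * B).
  by rewrite /K; field; rewrite gt_eqF.
lra.
Qed.

End moment_bound.

(** * From even moments to a general exponent *)

Lemma powR_le_scaled_power (R : realType) (N : nat) (r s y : R) :
  0 <= r <= N%:R -> 0 < s -> 0 <= y -> y `^ r <= s `^ r * (y / s) ^+ N + s `^ r.
Proof.
move=> /andP[r0 rN] s0 y0; have ys0 : 0 <= y / s by rewrite divr_ge0// ltW.
(* Up to [s] the last summand suffices; beyond it [y / s >= 1], so raising the exponent from [r] to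
   [N] only increases the power. *)
have [ys|/ltW sy] := leP y s.
  apply: ler_wpDl; first by rewrite mulr_ge0 ?powR_ge0 ?exprn_ge0.
  by rewrite ge0_ler_powR// nnegrE ltW.
apply: ler_wpDr; first exact: powR_ge0.
have -> : y `^ r = s `^ r * (y / s) `^ r.
  by rewrite -powRM ?(ltW s0)// mulrC divfK// gt_eqF.
rewrite ler_wpM2l ?powR_ge0// -powR_mulrn// ler_powR//.
by rewrite ler_pdivlMr// mul1r.
Qed.

Lemma powR_1D_le (R : realType) (r y : R) : 0 <= r -> 0 <= y ->
  (1 + y) `^ r <= 2 `^ r * (1 + y `^ r).
Proof.
move=> r0 y0; have [y1|/ltW y1] := leP y 1.
  apply: (@le_trans _ _ (2 `^ r)); last by rewrite ler_peMr ?powR_ge0// lerDl powR_ge0.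
  by rewrite ge0_ler_powR// ?nnegrE ?addr_ge0//; lra.
apply: (@le_trans _ _ ((2 * y) `^ r)).
  by rewrite ge0_ler_powR// ?nnegrE ?addr_ge0 ?mulr_ge0//; lra.
by rewrite powRM// ler_wpM2l ?powR_ge0// lerDr.
Qed.

Theorem theorem4p1 (R : realType) (d D : nat)
  (b : 'cV[R]_d -> 'cV[R]_d) (sigma : 'cV[R]_d -> 'M[R]_(d, D))
  (L1 L2 c1 L3 q : R)
  (hL1 : 0 < L1) (hL2 : 0 < L2)
  (hsig_lip : forall u1 u2, hsnorm (sigma u1 - sigma u2) <= L1 * vnorm (u1 - u2))
  (hsig_bd : forall u, hsnorm (sigma u) <= L2)
  (hc1 : 15 / 2 * L1 ^+ 2 < c1) (hL3 : 0 < L3) (hq : 1 <= q)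
  (hb_mon : forall u1 u2, vdot (u1 - u2) (b u1 - b u2) <= - c1 * vnorm (u1 - u2) ^+ 2)
  (hb_lip : forall u1 u2, vnorm (b u1 - b u2) <=
      L3 * (1 + vnorm u1 `^ (q - 1) + vnorm u2 `^ (q - 1)) * vnorm (u1 - u2))
  (r : R) (hr : 1 <= r) :
  exists K : R, 0 < K /\
    forall (dT : measure_display) (T : measurableType dT) (P : probability T R)
      (W : R -> T -> 'cV[R]_D), is_std_BM P W ->
    forall (tau : R), 0 < tau -> tau <= 1 ->
    forall (x : 'cV[R]_d) (X : nat -> T -> 'cV[R]_d),
      (forall w, X 0%N w = x) ->
      (forall (n : nat) w, X n.+1 w =
          X n w + tau *: b (X n.+1 w)
          + sigma (X n w) *m (W (n.+1%:R * tau) w - W (n%:R * tau) w)) ->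
      (ereal_sup (range (fun n : nat => \int[P]_w ((vnorm (X n w)) `^ r)%:E))
         <= (K * (1 + vnorm x `^ r))%:E)%E.
Proof.
have c1_gt0 : 0 < c1.
  by apply: le_lt_trans hc1; rewrite !mulr_ge0 ?exprn_ge0 ?(ltW hL1).
have r0 : 0 <= r by apply: le_trans hr.
have b_mon u v : vdot (u - v) (b u - b v) <= - c1 * vdot (u - v) (u - v).
  by rewrite -sqr_vnorm.
(* [N] is an even integer above [r], and the [k.+2]-th power of [vdot v v] is the [N]-th power of
   the norm. *)
pose k := Num.truncn r; pose N := (2 * k.+2)%N.
have rN : 0 <= r <= N%:R.
  rewrite r0 (le_trans (ltW (truncnS_gt r)))// ler_nat /N mulSn.
  by rewrite (leq_trans (leqnSn _))// leq_addr.
have [K K0 moment] := even_moment_bound R d D b sigma L1 L2 c1 L3 q k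
  (ltW hL1) (ltW hL2) hsig_lip hsig_bd c1_gt0 hL3 hq b_mon hb_lip.
(* [1 + K] bounds the scaled even moment, one more unit is the additive term of
   [powR_le_scaled_power], and [powR_1D_le] contributes the power of 2. *)
exists ((2 + K) * 2 `^ r); split; first by rewrite mulr_gt0 ?powR_gt0// ltr_wpDr.
move=> dT T P W [_ _ mW indepW lawW] tau tau0 tau1 x X X0 XS.
pose Z n w := W (n.+1%:R * tau) w - W (n%:R * tau) w.
have time_ge0 n : 0 <= n%:R * tau by rewrite mulr_ge0// ltW.
have timeS n : n%:R * tau < n.+1%:R * tau by rewrite ltr_pM2r// ltr_nat.
have mZ n i : measurable_fun [set: T] (fun w => Z n w i 0).
  by under eq_fun do rewrite !mxE; apply: measurable_funB; exact: mW (time_ge0 _).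
have indepZ n : mutually_independent P
    (fun p : 'I_n.+1 * 'I_D => fun w => Z p.1 w p.2 0).
  have := indepW n.+1 (fun j => j%:R * tau) (time_ge0 0%N) timeS.
  by congr mutually_independent; apply/funext => p; apply/funext => w; rewrite !mxE.
have lawZ n i (B : set R) : measurable B ->
    P ((fun w => Z n w i 0) @^-1` B) = normal_prob 0 (Num.sqrt tau) B.
  move=> mB; have := lawW _ _ i B (time_ge0 n) (timeS n) mB.
  have -> : n.+1%:R * tau - n%:R * tau = tau by rewrite -natr1; ring.
  move=> <-.
  by congr (P (_ @^-1` B)); apply/funext => w; rewrite !mxE.
have mX n i : measurable_fun [set: T] (fun w => X n w i 0).
  have b_diss u v : vdot (u - v) (b u - b v) <= 0.
    by apply: le_trans (b_mon u v) _; rewrite mulNr oppr_le0 mulr_ge0 ?vdot_ge0// ltW.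
  apply: (measurable_scheme _ _ b sigma L1 L3 q tau _ _ _ _ _ _ _ n x X Z) => //; exact: ltW.
apply: ge_ereal_sup => _ [n _ <-].
(* With this scale the expectation of [V] is at most [(1 + K) * s ^+ N], so dividing by [s ^+ N]
   removes the dependence on [x]. *)
pose s := 1 + vnorm x; have x0 := vnorm_ge0 x.
have s0 : 0 < s by rewrite ltr_wpDr.
have VE (v : 'cV[R]_d) : vdot v v ^+ k.+2 = vnorm v ^+ N by rewrite -sqr_vnorm -exprM.
pose V w := vdot (X n w) (X n w) ^+ k.+2.
have mV : measurable_fun [set: T] V by apply: measurable_funX; exact: measurable_vdot.
have V0 w : 0 <= V w by rewrite exprn_ge0// vdot_ge0.
have IV := moment dT T P tau Z tau0 tau1 mZ indepZ lawZ x X X0 XS n.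
have sN : 0 < s ^+ N by rewrite exprn_gt0.
have X_le w : vnorm (X n w) `^ r <= s `^ r / s ^+ N * V w + 0 * V w + s `^ r.
  rewrite mul0r addr0 /V VE mulrAC -mulrA -expr_div_n.
  by apply: powR_le_scaled_power => //; exact: vnorm_ge0.
have mXr : measurable_fun [set: T] (fun w => vnorm (X n w) `^ r).
  by apply: (measurableT_comp (measurable_powR _)); exact: measurable_vnorm.
apply: le_trans (integral_affine_le P _ V V _ _ _ _ _ mXr mV mV _ V0 V0 _ _ _ X_le IV IV) _ => //.
- by move=> w; exact: powR_ge0.
- by rewrite divr_ge0 ?powR_ge0// ltW.
- exact: powR_ge0.
rewrite lee_fin mul0r addr0.
have Vx : vdot x x ^+ k.+2 + K <= (1 + K) * s ^+ N.
  rewrite VE mulrDl mul1r lerD//; first by rewrite lerXn2r ?nnegrE ?(ltW s0)// lerDr.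
  by rewrite ler_peMr// exprn_ege1// lerDl.
apply: (@le_trans _ _ ((2 + K) * s `^ r)).
  have -> : (2 + K) * s `^ r = s `^ r / s ^+ N * ((1 + K) * s ^+ N) + s `^ r.
    by field; rewrite gt_eqF.
  by rewrite lerD2r ler_wpM2l// divr_ge0 ?powR_ge0// ltW.
by rewrite -mulrA ler_wpM2l ?addr_ge0// powR_1D_le.
Qed.
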